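(* Let $T\in(0,\infty)$. Let $A$ and $B$ be defined and integrable functions on $(0,T)$, with $A,B\ge e$, such that $A$ is absolutely continuous on $(0,T)$ and continuous on $[0,T)$. Suppose that $$ A'(t)+B(t)\le K A(t)\log B(t)\log\log B(t) $$ for (almost every) $t\in(0,T)$, where $K\ge1$ is a constant. Then $$ 2A(t)+\int_0^tB(s)\,ds\le 512K^2Q^2(t)+2A(0) $$ for any $t\in[0,T)$, where $$ Q(t)=\exp\left\{\exp\left\{(\log\log A(0)+260K^2t)e^{Kt}\right\}\right\}. $$
   Context: $A'$ denotes the almost-everywhere derivative of the absolutely continuous function $A$; $Q^2(t)=(Q(t))^2$. *)

(* Defs.v *)
From HB Require Import structures.
From mathcomp Require Import all_boot all_order all_algebra.
From mathcomp Require Import all_classical all_reals all_analysis.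

Set Implicit Arguments.
Unset Strict Implicit.
Unset Printing Implicit Defensive.

Import Order.TTheory GRing.Theory Num.Theory.
Import numFieldNormedType.Exports.

Local Open Scope classical_set_scope.
Local Open Scope ring_scope.

(* Epsilon-delta absolute continuity on an interval [I], uniform over the whole
   of [I]: the families range over finitely many non-overlapping subintervals
   whose endpoints belong to [I]. *)
Definition abs_continuous_on (R : realType) (I : set R) (f : R -> R) : Prop :=
  forall eps : R, 0 < eps -> exists2 delta : R, 0 < delta &
    forall (n : nat) (a b : 'I_n -> R),
      (forall i, a i < b i) ->
      (forall i, `[a i, b i] `<=` I) ->
      trivIset [set: 'I_n] (fun i => `]a i, b i[%classic) ->
      \sum_(i < n) (b i - a i) < delta ->
      \sum_(i < n) `|f (b i) - f (a i)| < eps.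

Definition Qbound (R : realType) (A0 K t : R) : R :=
  expR (expR ((ln (ln A0) + 260 * K ^+ 2 * t) * expR (K * t))).

(* Main.v *)
Require Import Defs.
From HB Require Import structures.
From mathcomp Require Import all_boot all_order all_algebra.
From mathcomp Require Import all_classical all_reals all_analysis.
From mathcomp Require Import measurable_realfun.
From mathcomp Require Import ring lra.

(** Put [c = 260 K^2].  Writing [B = A e^u] with [u >= 0] (when [B <= A] the
    next bound is immediate), the logarithms in [K A log B loglog B] grow only
    polynomially in [u] while [B / (2A) = e^u / 2] is exponential, so half of
    [B] absorbs everything except the rate [G(A) = A log A (K loglog A + c)]:
    this is [log_loglog_young].  The hypothesis thus gives [A' + B/2 <= G(A)]
    almost everywhere.

    The rate [G] is nondecreasing and is dominated along the explicit function
    [Y(t) = exp (exp ((z + c t) e^(K t)))], in the sense that [Y' >= G(Y)]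
    ([dbarrier_ge]).  On any interval where [A <= Y] one then has
    [A' + B/2 <= G(A) <= G(Y) <= Y'], and integrating gives
    [A(t) - A(s) + (1/2) int_s^t B <= Y(t) - Y(s)] ([barrier_increment_le]).
    If [Y(0) > A(0)], this forbids a first time at which [A] reaches [Y], as
    the gap [Y - A] cannot shrink before that time.  Hence [A < Y] on all of
    [0, T), and letting [s] tend to 0 in the integrated inequality bounds
    [A(t) + (1/2) int_0^t B] by [Y(t)].  Finally, choosing
    [z = loglog A(0) + (log 2) e^(- K t)] for the given [t] makes [Y(0) > A(0)]
    while [Y(t) = Q(t)^2].

    The integration step needs that an absolutely continuous [f] is
    differentiable almost everywhere and is the integral of its derivative
    ([ac_density], [ac_derive1_density]).  The total variation [V] of [f] is
    again absolutely continuous ([ac_itv_variation]), so [f = V - (V - f)]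
    reduces the claim to a nondecreasing absolutely continuous [F].  Its
    Stieltjes measure vanishes on Lebesgue-null sets, because such a set lies
    in an open set of small measure, that is, in a disjoint union of intervals
    of small total length ([lebesgue_stieltjes_null]).  The Radon-Nikodym
    theorem provides a density, and Lebesgue's differentiation theorem
    identifies it with the derivative. *)

Import Order.TTheory GRing.Theory Num.Theory.
Import numFieldNormedType.Exports.

Local Open Scope classical_set_scope.
Local Open Scope ring_scope.

(** * Absolute continuity and total variation *)

Section absolute_continuity.
Set Implicit Arguments.
Unset Strict Implicit.
Unset Printing Implicit Defensive.
Context {R : realType}.
Implicit Types (a b d e x y : R) (f g : R -> R) (s t : seq (R * R)).

Definition nonoverlapping (p q : R * R) := (p.2 <= q.1) || (q.2 <= p.1).

(** Finite families of intervals are lists of endpoints here, so that an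
    interval can be replaced by the pieces of a partition of it and the sum of
    the total variations can be handled by induction on the list. *)
Definition itv_family a b s :=
  all (fun p => [&& a <= p.1, p.1 < p.2 & p.2 <= b]) s &&
  pairwise nonoverlapping s.

Definition increment f s := \sum_(p <- s) `|f p.2 - f p.1|.

Definition total_length s := \sum_(p <- s) (p.2 - p.1).

Lemma increment_cat f s t :
  increment f (s ++ t) = increment f s + increment f t.
Proof. exact: big_cat. Qed.

Lemma total_length_cat s t :
  total_length (s ++ t) = total_length s + total_length t.
Proof. exact: big_cat. Qed.

(** The bound on the increments is not strict because this form, unlike the
    strict one, passes to the supremum over partitions. *)
Definition ac_itv a b f := forall e, 0 < e -> exists2 d, 0 < d &
  forall s, itv_family a b s -> total_length s < d -> increment f s <= e.

Lemma abs_continuous_on_ac_itv (I : set R) a b f :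
  `[a, b] `<=` I -> abs_continuous_on I f -> ac_itv a b f.
Proof.
move=> abI fI e e0; have [d d0 H] := fI _ e0.
exists d => // s /andP[/allP sab sd].
rewrite /total_length /increment.
rewrite (big_nth (0,0)) [in X in _ -> X](big_nth (0,0)) !big_mkord => sl.
apply/ltW/(H _ (fun i : 'I_(size s) => (nth (0,0) s i).1)
  (fun i : 'I_(size s) => (nth (0,0) s i).2)) => //.
- by move=> i; have /and3P[] := sab _ (mem_nth (0,0) (ltn_ord i)).
- move=> i; have /and3P[ai _ ib] := sab _ (mem_nth (0,0) (ltn_ord i)).
  apply: subset_trans abI; apply: subset_itv; by rewrite bnd_simp.
- move=> i j _ _ [x [/= xi xj]]; apply: contrapT => ij.
  wlog lij : i j xi xj ij / (i < j)%N.
    move=> W; have [|ji|/val_inj//] := ltngtP i j; first exact: W.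
    by apply: (W j i) => // /esym.
  have /pairwiseP := sd => /(_ (0,0) i j).
  rewrite !inE => /(_ (ltn_ord i) (ltn_ord j) lij).
  by move: xi xj; rewrite !in_itv/= => /andP[? ?] /andP[? ?] /orP[?|?]; lra.
Qed.

Definition pieces (x : R) (l : seq R) := zip (x :: l) l.

Lemma itv_family_pieces x (l : seq R) : path <%R x l ->
  itv_family x (last x l) (pieces x l).
Proof.
elim: l x => [//|y l IH] x /= /andP[xy yl].
have /andP[IH1 IH2] := IH y yl.
have ylast : y <= last y l.
  by have := @itv_partition_le _ _ y (last y l) l; apply.
apply/andP; split => /=.
  rewrite lexx xy ylast/=; apply: sub_all IH1 => -[p q] /= /and3P[yp -> ->].
  by rewrite (le_trans (ltW xy)).
rewrite IH2 andbT; apply: sub_all IH1 => -[p q] /= /and3P[yp _ _].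
by rewrite /nonoverlapping/= yp.
Qed.

Lemma total_length_pieces x (l : seq R) :
  total_length (pieces x l) = last x l - x.
Proof.
rewrite /total_length; elim: l x => [|y l IH] x /=.
  by rewrite big_nil subrr.
by rewrite big_cons IH /= addrC addrA subrK.
Qed.

Lemma increment_pieces x y (l : seq R) f : itv_partition x y l ->
  increment f (pieces x l) = variation x y f l.
Proof.
move=> /variation_zip ->; rewrite /increment /pieces.
elim: l x => [|z l IH] x /=; first by rewrite !big_nil.
by rewrite !big_cons IH.
Qed.

(** Subdividing one member of a family leaves it non-overlapping. *)
Lemma itv_family_refine a b p s t : itv_family a b (p :: s) ->
  itv_family p.1 p.2 t -> itv_family a b (t ++ s).
Proof.
rewrite /itv_family/= => /andP[/andP[/and3P[ap _ pb] sab] /andP[ps sd]].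
move=> /andP[tp td]; rewrite all_cat sab pairwise_cat sd td !andbT.
apply/andP; split.
  apply: sub_all tp => q /and3P[pq -> qp].
  by rewrite (le_trans ap)//= (le_trans qp).
apply/allrelP => q r qt rs; move/allP : tp => /(_ _ qt)/and3P[pq qq qp].
move/allP : ps => /(_ _ rs); rewrite /nonoverlapping.
by move=> /orP[pr|rp]; [rewrite (le_trans qp)|rewrite (le_trans rp)// orbT].
Qed.

Lemma itv_family_catCA a b s t u :
  itv_family a b (s ++ t ++ u) = itv_family a b (t ++ s ++ u).
Proof.
have sym r r' : allrel nonoverlapping r r' = allrel nonoverlapping r' r.
  by rewrite allrelC; apply: eq_allrel => p q; rewrite /nonoverlapping orbC.
rewrite /itv_family !all_cat !pairwise_cat !allrel_catr (sym t s).
by do ![case: (all _ _)|case: (pairwise _ _)|case: (allrel _ _ _)].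
Qed.

(** The intervals of [s] have been promoted from increments to total
    variations, those of [t] not yet.  Promoting one more interval [p] amounts
    to taking a supremum over the partitions of [p]; the pieces of each
    partition join [t], and the refined family has the same total length, so
    the bound [e] is uniform in the partition. *)
Lemma sum_total_variation_le a b f e d :
  (forall s, itv_family a b s -> total_length s < d -> increment f s <= e) ->
  forall s t, itv_family a b (s ++ t) -> total_length (s ++ t) < d ->
  (\sum_(p <- s) total_variation p.1 p.2 f + (increment f t)%:E <= e%:E)%E.
Proof.
move=> H; elim=> [|p s IH] t.
  by rewrite big_nil add0e lee_fin; exact: H.
move=> stab stl.
have /andP[/andP[/and3P[_ p12 _] _] _] := stab.
have step l : itv_partition p.1 p.2 l ->
    (\sum_(p <- s) total_variation p.1 p.2 f +
     (variation p.1 p.2 f l + increment f t)%:E <= e%:E)%E.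
  move=> pl; have [pl1 /eqP pl2] := pl.
  have -> : variation p.1 p.2 f l + increment f t =
      increment f (pieces p.1 l ++ t).
    by rewrite increment_cat (increment_pieces _ pl).
  apply: IH.
    rewrite itv_family_catCA; apply: itv_family_refine stab _.
    by rewrite -[in X in itv_family _ X]pl2; exact: itv_family_pieces.
  move: stl; rewrite -cat1s !total_length_cat total_length_pieces pl2.
  by rewrite [total_length [:: p]]big_seq1; lra.
have sfin : \sum_(p <- s) total_variation p.1 p.2 f \is a fin_num.
  rewrite ge0_fin_numE.
    have := step _ (itv_partition1 p12); rewrite -leeBrDr//.
    move=> /le_lt_trans; apply.
    by rewrite -EFinB ltry.
  rewrite big_seq; apply: sume_ge0 => q qs; apply: total_variation_ge0.
  have /andP[/allP/(_ q) + _] := stab.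
  by rewrite inE mem_cat qs/= orbT => /(_ isT)/and3P[_ /ltW].
rewrite big_cons -addeA -leeBrDr; last by rewrite fin_numD sfin.
apply: ge_ereal_sup => _ [_ [l pl <-] <-].
rewrite leeBrDr; last by rewrite fin_numD sfin.
by rewrite addeCA -EFinD; exact: step.
Qed.

Lemma itv_family1 a b x y : a <= x -> x < y -> y <= b ->
  itv_family a b [:: (x, y)].
Proof. by move=> ax xy yb; rewrite /itv_family/= ax xy yb. Qed.

(** The variation is at most 1 over every interval shorter than the [d]
    associated with [1], and [a, b] is covered by finitely many of these. *)
Lemma ac_itv_bounded_variation a b f : a <= b -> ac_itv a b f ->
  bounded_variation a b f.
Proof.
move=> ab fab; have [d d0 H] := fab _ ltr01.
have TV1 x y : a <= x -> x < y -> y <= b -> y - x < d ->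
    (total_variation x y f < +oo)%E.
  move=> ax xy yb yxd.
  have := sum_total_variation_le H (s := [:: (x, y)]) (t := [::]).
  rewrite cats0 /total_length /increment !big_seq1 big_nil adde0/=.
  by move=> /(_ (itv_family1 ax xy yb) yxd)/le_lt_trans; apply; rewrite ltry.
pose h := d / 2.
have h0 : 0 < h by rewrite divr_gt0.
have hd : h < d by rewrite /h; lra.
(* Induction on the number of steps of length [h] needed to reach [x]. *)
suff TVn n : forall x, a <= x <= b -> x - a <= n%:R * h ->
    (total_variation a x f < +oo)%E.
  apply/bounded_variationP => //; rewrite ge0_fin_numE ?total_variation_ge0//.
  apply: (TVn (Num.bound ((b - a) / h))); rewrite ?ab ?lexx//.
  rewrite -ler_pdivrMr//; apply/ltW/archi_boundP.
  by rewrite divr_ge0 ?subr_ge0// ltW.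
elim: n => [|n IH] x /andP[ax xb] xn.
  have -> : x = a.
    by apply/eqP; rewrite eq_le ax andbT; move: xn; rewrite mul0r; lra.
  by rewrite total_variationxx ltry.
have [xah|xah] := leP (x - a) h.
  move: ax; rewrite le_eqVlt => /predU1P[<-|ax].
    by rewrite total_variationxx ltry.
  by apply: TV1 => //; rewrite (le_lt_trans xah).
rewrite (@total_variationD _ _ _ (x - h)); [|lra|lra].
apply: lte_add_pinfty.
  apply: IH; first by apply/andP; split; lra.
  by move: xn; rewrite -natr1 mulrDl mul1r; lra.
by apply: TV1 => //; lra.
Qed.

Definition variation_fun a f x := fine (total_variation a x f).

Lemma variation_funB a b f x y : bounded_variation a b f ->
  a <= x -> x <= y -> y <= b ->
  (variation_fun a f y - variation_fun a f x)%:E = total_variation x y f.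
Proof.
move=> bv ax xy yb; rewrite /variation_fun (total_variationD f ax xy).
have bvy : bounded_variation a y f by apply: bounded_variationl bv => //; lra.
have /bounded_variationP fx : bounded_variation a x f.
  by apply: bounded_variationl bvy.
have /bounded_variationP fy : bounded_variation x y f.
  by apply: bounded_variationr bvy.
by rewrite fineD ?fx ?fy// addrC addKr fineK ?fy.
Qed.

Lemma variation_fun_ge a b f x y : bounded_variation a b f ->
  a <= x -> x <= y -> y <= b ->
  `|f y - f x| <= variation_fun a f y - variation_fun a f x.
Proof.
move=> bv ax xy yb; rewrite -lee_fin (variation_funB bv)//.
exact: total_variation_ge.
Qed.

Lemma ac_itv_variation a b f : a <= b -> ac_itv a b f ->
  ac_itv a b (variation_fun a f).
Proof.
move=> ab fab e /fab[d d0 H]; exists d => // s sab sd.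
have bv := ac_itv_bounded_variation ab fab.
have := sum_total_variation_le H (s := s) (t := [::]).
rewrite cats0 => /(_ sab sd).
rewrite {1}/increment big_nil adde0 -lee_fin; apply: le_trans.
rewrite /increment -sumEFin big_seq [leRHS]big_seq; apply: lee_sum => p ps.
have /andP[/allP/(_ _ ps)/and3P[ap /ltW pp pb] _] := sab.
rewrite -(variation_funB bv)// ger0_norm//.
by apply: le_trans (variation_fun_ge bv ap pp pb).
Qed.

Lemma ac_itvB a b f g : ac_itv a b f -> ac_itv a b g -> ac_itv a b (f \- g).
Proof.
move=> fab gab e e0; have e20 : 0 < e / 2 by rewrite divr_gt0.
have [d1 d10 H1] := fab _ e20; have [d2 d20 H2] := gab _ e20.
exists (Num.min d1 d2); first by rewrite lt_min d10.
move=> s sab; rewrite lt_min => /andP[/(H1 _ sab) fs /(H2 _ sab) gs].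
rewrite (splitr e); apply: le_trans (lerD fs gs).
rewrite /increment -big_split/=; apply: ler_sum => p _.
have -> : f p.2 - g p.2 - (f p.1 - g p.1) =
    f p.2 - f p.1 - (g p.2 - g p.1) by ring.
exact: ler_normB.
Qed.

(** Uniform continuity, from the families with a single interval. *)
Lemma ac_itv_dist a b f : ac_itv a b f -> forall e, 0 < e -> exists2 d, 0 < d &
  forall x y, a <= x <= b -> a <= y <= b -> `|x - y| < d -> `|f x - f y| <= e.
Proof.
move=> fab e e0; have [d d0 H] := fab _ e0; exists d => // x y.
wlog xy : x y / x < y.
  move=> W xab yab; have [xy|yx|->] := ltgtP x y; first exact: W.
    by rewrite distrC => yxd; rewrite distrC; exact: W yab xab yxd.
  by move=> _; rewrite subrr normr0 ltW.
move=> /andP[ax _] /andP[_ yb]; rewrite distrC gtr0_norm ?subr_gt0// => xyd.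
rewrite distrC; have := H _ (itv_family1 ax xy yb).
by rewrite /total_length /increment !big_seq1; exact.
Qed.

End absolute_continuity.

Section logarithmic_gronwall.
Set Implicit Arguments.
Unset Strict Implicit.
Unset Printing Implicit Defensive.
Context {R : realType}.
Implicit Types (a b c d e s t u x y z K : R) (f g A B : R -> R).
Notation mu := (@lebesgue_measure R).

(** * Densities of absolutely continuous functions *)

Lemma lebesgue_stieltjes_itvoc (F : cumulative R R) x y : x <= y ->
  lebesgue_stieltjes_measure F `]x, y] = (F y - F x)%:E.
Proof.
move=> xy; rewrite /lebesgue_stieltjes_measure /measure_extension.
by rewrite measurable_mu_extE/=; [rewrite wlength_itv_bnd|exact: is_ocitv].
Qed.

(** Openness excludes the infimum and the supremum from the interval. *)
Lemma open_interval_endpoints a b (I : set R) : open I -> is_interval I ->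
  I `<=` `]a, b[ -> I !=set0 -> exists p : R * R,
  [/\ a <= p.1, p.1 < p.2, p.2 <= b & I = `]p.1, p.2[%classic].
Proof.
move=> oI iI Iab I0.
have hl : has_lbound I.
  by exists a => x /Iab/=; rewrite in_itv/= => /andP[/ltW].
have hu : has_ubound I.
  by exists b => x /Iab/=; rewrite in_itv/= => /andP[_ /ltW].
have hi : has_inf I by split. have hs : has_sup I by split.
have II : I = `]inf I, sup I[%classic.
  apply/seteqP; split => x /=.
    move=> Ix; rewrite in_itv/=; apply/andP; split.
      have [e /= e0 /(_ (x - e / 2))] := oI _ Ix.
      rewrite /ball/= opprD opprK addrA subrr add0r gtr0_norm ?divr_gt0//.
      move=> /(_ ltac:(lra)) Ie; have := ge_inf hl Ie; lra.
    have [e /= e0 /(_ (x + e / 2))] := oI _ Ix.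
    rewrite /ball/= opprD addrA subrr add0r normrN gtr0_norm ?divr_gt0//.
    move=> /(_ ltac:(lra)) Ie; have := ub_le_sup hu Ie; lra.
  rewrite in_itv/= => /andP[ix xs].
  have [y Iy yx] : exists2 y, I y & y < x by exact: inf_lt.
  have [z Iz xz] : exists2 z, I z & x < z by exact: sup_gt.
  by apply: (iI y z) => //; rewrite !ltW.
exists (inf I, sup I); split => //=.
- by apply: lb_le_inf => // x /Iab/=; rewrite in_itv/= => /andP[/ltW].
- by case: I0 => x; rewrite {1}II/= in_itv/= => /andP[]; exact: lt_trans.
- by apply: ge_sup => // x /Iab/=; rewrite in_itv/= => /andP[_ /ltW].
Qed.

Lemma nonoverlapping_itvoo (p q : R * R) : p.1 < p.2 -> q.1 < q.2 ->
  `]p.1, p.2[ `&` `]q.1, q.2[ = set0 -> nonoverlapping p q.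
Proof.
move=> pp qq pq0; rewrite /nonoverlapping leNgt (leNgt q.2) -negb_and.
apply/negP => /andP[h1 h2].
have : (`]p.1, p.2[ `&` `]q.1, q.2[) ((Num.max p.1 q.1 + Num.min p.2 q.2) / 2).
  rewrite /= !in_itv/=.
  have hm : Num.max p.1 q.1 < Num.min p.2 q.2.
    by rewrite gt_max !lt_min pp h1 h2 qq.
  have [m1 m2] := (midf_lt hm).
  have : p.1 <= Num.max p.1 q.1 by rewrite le_max lexx.
  have : q.1 <= Num.max p.1 q.1 by rewrite le_max lexx orbT.
  have : Num.min p.2 q.2 <= p.2 by rewrite ge_min lexx.
  have : Num.min p.2 q.2 <= q.2 by rewrite ge_min lexx orbT.
  by move=> *; split; apply/andP; split; lra.
by rewrite pq0.
Qed.

(** The components of [W] are disjoint intervals, so any finitely many of them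
    form a family of total length less than [d], to which the bound on the
    increments applies; countable additivity gives it for the whole of [W]. *)
Lemma lebesgue_stieltjes_open_le (F : cumulative R R) a b e d (W : set R) :
  (forall s : seq (R * R), itv_family a b s -> total_length s < d ->
    increment F s <= e) ->
  open W -> W `<=` `]a, b[ -> (mu W < d%:E)%E ->
  (lebesgue_stieltjes_measure F W <= e%:E)%E.
Proof.
move=> H oW Wab Wd; pose I := open_disjoint_itv oW.
have oI k : open (I k) by exact: open_disjoint_itv_open.
have iI k : is_interval (I k) by apply: open_disjoint_itv_is_interval.
have mI k : measurable (I k) by exact: open_measurable.
have tI : trivIset setT I by exact: open_disjoint_itv_trivIset.
have WI : W = \bigcup_k I k by exact: open_disjoint_itv_bigcup.
have IW k : I k `<=` `]a, b[.
  by apply: subset_trans Wab; rewrite WI; exact: bigcup_sup.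
have [p pI] : {p : nat -> R * R & forall k, I k !=set0 ->
   [/\ a <= (p k).1, (p k).1 < (p k).2, (p k).2 <= b &
       I k = `](p k).1, (p k).2[%classic]}.
  apply: (@choice _ _ (fun k q => I k !=set0 ->
    [/\ a <= q.1, q.1 < q.2, q.2 <= b & I k = `]q.1, q.2[%classic])) => k.
  have [I0|/set0P/negP/negPn/eqP I0] := pselect (I k !=set0).
    have [q qP] :=
      open_interval_endpoints (oI k) (iI k) (@IW k) I0.
    by exists q.
  by exists (0, 0) => -[x]; rewrite I0.
pose P k := `[< I k !=set0 >].
pose s n := [seq p k | k <- index_iota 0 n & P k].
have sab n : itv_family a b (s n).
  apply/andP; split.
    apply/allP => q /mapP[k]; rewrite mem_filter => /andP[/asboolP Ik _] ->.
    by have [-> -> ->] := pI _ Ik.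
  rewrite pairwise_map; apply: (@sub_in_pairwise _ P [rel k l | k != l]).
  - move=> k l /asboolP Ik /asboolP Il /= kl.
    have [_ pk _ Ek] := pI _ Ik; have [_ pl _ El] := pI _ Il.
    apply: nonoverlapping_itvoo => //; rewrite -Ek -El.
    by move/trivIsetP : tI; exact.
  - exact: filter_all.
  - by rewrite -uniq_pairwise filter_uniq// iota_uniq.
have I0 k (m : {measure set (measurableTypeR R) -> \bar R}) :
    ~~ P k -> m (I k) = 0%E.
  by move=> /asboolPn/set0P/negP/negPn/eqP ->; exact: measure0.
have sumP n (m : {measure set (measurableTypeR R) -> \bar R}) :
    (\sum_(0 <= k < n) m (I k) = \sum_(0 <= k < n | P k) m (I k))%E.
  rewrite [RHS]big_mkcond/=; apply: eq_bigr => k _; case: ifPn => //; exact: I0.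
have muitv (q : R * R) : q.1 < q.2 -> mu `]q.1, q.2[ = (q.2 - q.1)%:E.
  by move=> qq; rewrite lebesgue_measure_itv/= lte_fin qq.
have sd n : total_length (s n) < d.
  rewrite -lte_fin; apply: le_lt_trans Wd.
  rewrite WI measure_semi_bigcup//; last first.
    by apply: bigcup_measurable => k _; exact: mI.
  apply: le_trans (nneseries_lim_ge n _); last by [].
  rewrite sumP /total_length big_map big_filter -sumEFin.
  apply: lee_sum => k /asboolP Ik.
  have [_ pk _ ->] := pI _ Ik.
  by rewrite -muitv.
rewrite WI measure_semi_bigcup//; last first.
  by apply: bigcup_measurable => k _; exact: mI.
apply: lime_le; first exact: is_cvg_nneseries.
apply: nearW => n; have := H _ (sab n) (sd n); rewrite -lee_fin.
apply: le_trans; rewrite sumP /increment big_map big_filter -sumEFin.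
apply: lee_sum => k /asboolP Ik.
have [_ pk _ Ek] := pI _ Ik.
apply: (@le_trans _ _ (lebesgue_stieltjes_measure F `](p k).1, (p k).2])).
  by rewrite Ek; apply: le_measure; rewrite ?inE//; exact: subset_itv_oo_oc.
have -> := lebesgue_stieltjes_itvoc F (ltW pk).
by rewrite lee_fin ler_norm.
Qed.

Lemma lebesgue_stieltjes_null (F : cumulative R R) a b (N : set R) :
  ac_itv a b F -> measurable N -> mu N = 0%E ->
  lebesgue_stieltjes_measure F (N `&` `]a, b[) = 0%E.
Proof.
move=> Fab mN N0; apply/eqP; rewrite eq_le measure_ge0 andbT.
apply/lee_addgt0Pr => e e0; rewrite add0e.
have [d d0 H] := Fab _ e0.
have [U [oU NU Ud]] : exists U : set R,
    [/\ open U, N `<=` U & (mu (U `\` N) < d%:E)%E].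
  have Nfin : (mu N < +oo)%E by rewrite N0.
  exact: lebesgue_regularity_outer.
have mU := open_measurable oU.
have {}Ud : (mu U < d%:E)%E.
  apply: le_lt_trans Ud; apply: (@le_trans _ _ (mu N + mu (U `\` N))%E).
    rewrite -[in leLHS](setDUK NU).
    by apply: measureU2 => //; exact: measurableD.
  by rewrite N0 add0e.
have oW : open (U `&` `]a, b[) by apply: openI => //; exact: interval_open.
apply: (@le_trans _ _ (lebesgue_stieltjes_measure F (U `&` `]a, b[))).
  apply: le_measure; rewrite ?inE; [exact: measurableI|exact: measurableI|].
  exact: setSI.
apply: (lebesgue_stieltjes_open_le H) => //.
apply: le_lt_trans Ud; apply: le_measure; rewrite ?inE//; exact: measurableI.
Qed.

(** Restricting the Stieltjes measure to the open interval makes it finite, as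
    the Radon-Nikodym theorem requires.  The representation is
    read off for [x < b], where [a, x] and ]a, b[ meet in ]a, x]. *)
Lemma cumulative_density (F : cumulative R R) a b : a < b -> ac_itv a b F ->
  exists2 g : R -> R, mu.-integrable setT (EFin \o g) &
    forall x, a <= x < b -> F x - F a = \int[mu]_(t in `[a, x]) g t.
Proof.
move=> ab Fab.
pose L : {measure set (measurableTypeR R) -> \bar R} :=
  lebesgue_stieltjes_measure F.
have LE x y : x <= y -> L `]x, y]%classic = (F y - F x)%:E.
  by move=> xy; exact: lebesgue_stieltjes_itvoc.
have mab : measurable (`]a, b[ : set (measurableTypeR R)) by [].
have Lab : (L `]a, b[%classic < +oo)%E.
  apply: (@le_lt_trans _ _ (L `]a, b]%classic)).
    by apply: le_measure; rewrite ?inE//; exact: subset_itv_oo_oc.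
  by rewrite LE ?ltW// ltry.
pose nu : {finite_measure set (measurableTypeR R) -> \bar R} :=
  mfrestr mab Lab.
have numu : nu `<< (mu : {measure set (measurableTypeR R) -> \bar R}).
  by apply/null_content_dominatesP => N mN N0; exact: lebesgue_stieltjes_null.
have [g [g0 gfin gint gE]] := radon_nikodym_sigma_finite (mu := mu) numu.
have gg : EFin \o (fine \o g) = g by apply/funext => x /=; rewrite fineK.
exists (fine \o g); first by rewrite gg.
move=> x /andP[ax xb].
rewrite /Rintegral -[X in integral _ _ X]/(EFin \o (fine \o g)) gg.
rewrite -gE//= /nu /= /mfrestr /mrestr.
have -> : `[a, x] `&` `]a, b[ = `]a, x]%classic.
  apply/seteqP; split => y /=; rewrite !in_itv/=.
    by move=> [/andP[_ ->] /andP[-> _]].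
  by move=> /andP[ay yx]; rewrite ay yx ltW//= (le_lt_trans yx).
by rewrite LE.
Qed.

(** A Stieltjes measure needs a monotone function on the whole line, hence the
    extension of [f] by constants outside [a, b]. *)
Lemma ac_nondecreasing_density a b f : a < b -> ac_itv a b f ->
  {in `[a, b] &, nondecreasing_fun f} ->
  exists2 g : R -> R, mu.-integrable setT (EFin \o g) &
    forall x, a <= x < b -> f x - f a = \int[mu]_(t in `[a, x]) g t.
Proof.
move=> ab fab nf; pose clamp x := Num.max a (Num.min x b).
have cab x : a <= clamp x <= b.
  by rewrite le_max lexx/= ge_max ge_min lexx orbT (ltW ab).
have cid x : a <= x <= b -> clamp x = x.
  by move=> /andP[ax xb]; rewrite /clamp min_l// max_r.
have nc : nondecreasing_fun clamp.
  move=> x y xy; rewrite /clamp !maxEle !minEle.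
  by case: (leP x b); case: (leP y b);
    rewrite ?(ltW ab); case: (leP a x); case: (leP a y); lra.
have cd x y : `|clamp x - clamp y| <= `|x - y|.
  wlog xy : x y / x <= y.
    move=> W; have [|/ltW] := leP x y; first exact: W.
    by rewrite distrC (distrC x); exact: W.
  rewrite distrC (distrC x) !ger0_norm ?subr_ge0//; last exact: nc.
  rewrite /clamp !maxEle !minEle.
  by case: (leP x b); case: (leP y b);
    rewrite ?(ltW ab); case: (leP a x); case: (leP a y); lra.
pose F x := f (clamp x).
have nF : nondecreasing F.
  by move=> x y xy; apply: nf; rewrite ?in_itv/= ?cab//; exact: nc.
have cF : right_continuous F.
  apply: right_continuousW => x; apply/cvgrPdist_le => e e0.
  have [d d0 H] := ac_itv_dist fab e0.
  near=> y; apply: H => //; apply: le_lt_trans (cd _ _) _.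
  by near: y; apply: cvgr_dist_lt.
pose mF := isCumulative.Build R _ R F nF cF.
pose cumF : cumulative R R := HB.pack F mF.
have [] := @cumulative_density cumF a b ab.
  move=> e /fab[d d0 H]; exists d => // s sab sd.
  rewrite (le_trans _ (H s sab sd))// /increment big_seq [leRHS]big_seq.
  apply: ler_sum => p ps.
  have /andP[/allP/(_ _ ps)/and3P[ap /ltW pp pb] _] := sab.
  rewrite /= /F !cid ?ap ?pb ?andbT//=; [exact: le_trans pb|exact: le_trans pp].
move=> g gint gE; exists g => // x /andP[ax xb]; rewrite -gE ?ax//= /F.
by rewrite !cid ?lexx ?ax ?ltW.
Unshelve. all: by end_near. Qed.

(** * The derivative of an absolutely continuous function *)

(** Both [V] and [V - f] are nondecreasing, [V] being the variation of [f]: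
    an increment of [f] is at most the corresponding increment of [V]. *)
Lemma ac_density a b f : a < b -> ac_itv a b f ->
  exists2 g : R -> R, mu.-integrable setT (EFin \o g) &
    forall x, a <= x < b -> f x - f a = \int[mu]_(t in `[a, x]) g t.
Proof.
move=> ab fab; have ab' := ltW ab; have bv := ac_itv_bounded_variation ab' fab.
pose V := variation_fun a f.
have Vab : ac_itv a b V := ac_itv_variation ab' fab.
have Wab : ac_itv a b (V \- f) := ac_itvB Vab fab.
have nV : {in `[a, b] &, nondecreasing_fun V}.
  move=> x y; rewrite !in_itv/= => /andP[ax xb] /andP[ay yb] xy.
  by rewrite -subr_ge0 (le_trans _ (variation_fun_ge bv ax xy yb)).
have nW : {in `[a, b] &, nondecreasing_fun (V \- f)}.
  move=> x y; rewrite !in_itv/= => /andP[ax xb] /andP[ay yb] xy.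
  have := variation_fun_ge bv ax xy yb; have := ler_norm (f y - f x).
  by rewrite -/V; lra.
have [g ig gE] := ac_nondecreasing_density ab Vab nV.
have [h ih hE] := ac_nondecreasing_density ab Wab nW.
exists (g \- h); first exact: (integrableB measurableT ig ih).
move=> x axb; rewrite RintegralB//=; last 2 first.
- exact: integrableS ig.
- exact: integrableS ih.
by rewrite -gE// -hE//=; ring.
Qed.

Lemma ae_le_Rintegral (D : set R) (f g : R -> R) : measurable D ->
  mu.-integrable D (EFin \o f) -> mu.-integrable D (EFin \o g) ->
  {ae mu, forall x, D x -> f x <= g x} ->
  \int[mu]_(x in D) f x <= \int[mu]_(x in D) g x.
Proof.
move=> mD fi gi [N [mN N0 fgN]]; rewrite /Rintegral.
rewrite (negligible_integral mN mD fi N0) (negligible_integral mN mD gi N0).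
apply: le_Rintegral; first exact: measurableD.
- by apply: integrableS fi => //; exact: measurableD.
- by apply: integrableS gi => //; exact: measurableD.
- move=> x [Dx Nx]; apply: contrapT => fg.
  by apply: Nx; apply: fgN => /= /(_ Dx).
Qed.

Lemma ac_derive1_density a b f (g : R -> R) : mu.-integrable setT (EFin \o g) ->
  (forall x, a <= x < b -> f x - f a = \int[mu]_(t in `[a, x]) g t) ->
  {ae mu, forall x, a < x < b -> derive1 f x = g x}.
Proof.
move=> ig gE.
have lg : locally_integrable setT g.
  by apply: open_integrable_locally => //; exact: openT.
have igS y : mu.-integrable [set` Interval (BLeft a) (BRight y)] (EFin \o g).
  exact: integrableS ig.
have := FTC1 igS lg => /=.
apply: (@filterS _ _ (ae_filter_ringOfSetsType mu)) => x /=.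
move=> + /andP[ax xb] => -[|dF F'x]; first by rewrite ?(ltW ax).
pose F y := \int[mu]_(t in `[a, y]) g t.
have fF : {near x, F \+ cst (f a) =1 f}.
  near=> y; rewrite /= /F -gE; first by rewrite subrK.
  have : y \in `]a, b[ by near: y; apply: near_in_itvoo; rewrite in_itv/= ax.
  by rewrite in_itv/= => /andP[/ltW -> ->].
rewrite -F'x derive1E -(near_eq_derive _ fF)// deriveD//.
by rewrite derive_cst addr0 -derive1E.
Unshelve. all: by end_near. Qed.

(** Absolute continuity is assumed slightly beyond [b] because the density
    represents [f] only at points that lie strictly before the right end. *)
Lemma ac_increment_le a b c f (h : R -> R) : a < b -> b < c -> ac_itv a c f ->
  mu.-integrable `]a, b[ (EFin \o h) ->
  {ae mu, forall x, a < x < b -> derive1 f x <= h x} ->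
  f b - f a <= \int[mu]_(x in `]a, b[) h x.
Proof.
move=> ab bc fac hi fh; have ac := lt_trans ab bc.
have [g ig gE] := ac_density ac fac.
have := ac_derive1_density ig gE => gf.
have igS (i : interval R) : mu.-integrable [set` i] (EFin \o g).
  exact: integrableS ig.
rewrite gE; last by rewrite (ltW ab).
rewrite -Rintegral_itv_obnd_cbnd// -Rintegral_itv_bndo_bndc//.
apply: ae_le_Rintegral => //.
move: fh gf; apply: (@filterS2 _ _ (ae_filter_ringOfSetsType mu)) => x fh gf.
rewrite /= in_itv/= => /andP[ax xb].
by rewrite -gf ?ax ?(lt_trans xb)// fh// ax.
Qed.

(** * The differential inequality for the barrier *)

Lemma ln_expR1_ge1 x : expR 1 <= x -> 1 <= ln x.
Proof.
move=> ex; rewrite -[leLHS]expRK ler_ln ?posrE ?expR_gt0//.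
exact: lt_le_trans (expR_gt0 _) ex.
Qed.

(** Since [ln (a + u) <= ln a + u / a], the left-hand side exceeds
    [K a ln a] by at most [K (u ln a + u + u^2)].  With [ln a <= 2 sqrt a],
    Young's inequality trades each of these terms for a multiple of [K^2 a]
    plus a part of [u^2 / 8 + u^4 / 96], which is at most [expR u / 2]; the
    multiples of [K^2 a] add up to 44. *)
Lemma xlnx_young K a u : 1 <= K -> 1 <= a -> 0 <= u ->
  K * (a + u) * ln (a + u) <= expR u / 2 + a * (K * ln a + 260 * K ^+ 2).
Proof.
move=> K1 a1 u0; have a0 : 0 < a by lra.
pose r := Num.sqrt a.
have r1 : 1 <= r by rewrite -[leLHS]sqrtr1; apply: ler_wsqrtr.
have ra : a = r ^+ 2 by rewrite sqr_sqrtr// ltW.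
have lna : ln a <= 2 * r.
  rewrite ra lnXn; last by lra.
  by rewrite -[leLHS]mulr_natl ler_pM2l// ltW// ln_sublinear//; lra.
have lnau : ln (a + u) <= ln a + u / a.
  have -> : a + u = a * (1 + u / a) by field; rewrite gt_eqF.
  have ua : 0 <= u / a by rewrite divr_ge0// ltW.
  by rewrite lnM ?posrE//; [rewrite lerD2l le_ln1Dx//; lra|lra].
(* [expR u / 2] is split into two quarters, one bounded below by the quadratic
   and the other by the quartic term of the exponential series. *)
have e2 : 1 + u ^+ 2 / 2 <= expR u.
  by have := expR_ge1Dxn 1 u0; rewrite (_ : 2`! = 2)%N.
have e4 : 1 + u ^+ 4 / 24 <= expR u.
  by have := expR_ge1Dxn 3 u0; rewrite (_ : 4`! = 24)%N.
have h1 : (a + u) * ln (a + u) <= a * ln a + 2 * (r * u) + u + u ^+ 2.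
  have s1 : (a + u) * ln (a + u) <= (a + u) * (ln a + u / a).
    by rewrite ler_wpM2l//; lra.
  apply: le_trans s1 _.
  have -> : (a + u) * (ln a + u / a) = a * ln a + u * ln a + u + u ^+ 2 / a.
    by field; rewrite gt_eqF.
  have s2 : u * ln a <= u * (2 * r) by rewrite ler_wpM2l.
  have s3 : u ^+ 2 / a <= u ^+ 2.
    by rewrite ler_pdivrMr// ler_peMr// sqr_ge0.
  lra.
have h2 : K * (2 * (r * u) + u + u ^+ 2) <=
    u ^+ 2 / 8 + u ^+ 4 / 96 + 44 * K ^+ 2 * a.
  have k1 : 2 * (K * (r * u)) <= 16 * (K ^+ 2 * r ^+ 2) + u ^+ 2 / 16.
    have := sqr_ge0 (4 * (K * r) - u / 4); lra.
  have k2 : K * u <= 4 * K ^+ 2 + u ^+ 2 / 16.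
    have := sqr_ge0 (2 * K - u / 4); lra.
  have k3 : K * u ^+ 2 <= 24 * K ^+ 2 + u ^+ 4 / 96.
    have := sqr_ge0 (K - u ^+ 2 / 48); nra.
  have k4 : K ^+ 2 <= K ^+ 2 * a by rewrite ler_peMr// sqr_ge0.
  rewrite -ra in k1; lra.
have h3 : 0 <= K ^+ 2 * a by rewrite mulr_ge0 ?sqr_ge0// ltW.
have h4 : K * ((a + u) * ln (a + u)) <=
    K * (a * ln a + 2 * (r * u) + u + u ^+ 2).
  by rewrite ler_wpM2l//; lra.
lra.
Qed.

(** This is [xlnx_young] for [ln a] and [u = ln b - ln a], multiplied by [a],
    since then [a * expR u = b].  If [b <= a], monotonicity of the logarithm
    suffices. *)
Lemma log_loglog_young K a b : 1 <= K -> expR 1 <= a -> expR 1 <= b ->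
  K * a * ln b * ln (ln b) <=
  b / 2 + a * ln a * (K * ln (ln a) + 260 * K ^+ 2).
Proof.
move=> K1 ae be.
have a0 : 0 < a := lt_le_trans (expR_gt0 _) ae.
have b0 : 0 < b := lt_le_trans (expR_gt0 _) be.
have la := ln_expR1_ge1 ae; have lb := ln_expR1_ge1 be.
have lla := ln_ge0 la; have llb := ln_ge0 lb.
have [ba|ab] := leP b a.
  have h1 : ln b <= ln a by rewrite ler_ln.
  have h2 : ln (ln b) <= ln (ln a) by rewrite ler_ln ?posrE//; lra.
  have h3 : ln b * ln (ln b) <= ln a * ln (ln a) by rewrite ler_pM//; lra.
  have h4 : K * a * (ln b * ln (ln b)) <= K * a * (ln a * ln (ln a)).
    by rewrite ler_wpM2l// mulr_ge0//; lra.
  have h5 : 0 <= a * ln a * K ^+ 2.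
    by rewrite !mulr_ge0//; lra.
  lra.
have u0 : 0 <= ln b - ln a by rewrite subr_ge0 ler_ln// ltW.
have := xlnx_young K1 la u0; rewrite addrC subrK expRB !lnK ?posrE// => h.
have : a * (K * ln b * ln (ln b)) <=
    a * (b / a / 2 + ln a * (K * ln (ln a) + 260 * K ^+ 2)).
  by rewrite ler_wpM2l// ltW.
have -> : a * (b / a / 2 + ln a * (K * ln (ln a) + 260 * K ^+ 2)) =
  b / 2 + a * ln a * (K * ln (ln a) + 260 * K ^+ 2) by field; rewrite gt_eqF.
lra.
Qed.

Lemma rate_le K c a y : 0 <= K -> 0 <= c -> expR 1 <= a -> a <= y ->
  a * ln a * (K * ln (ln a) + c) <= y * ln y * (K * ln (ln y) + c).
Proof.
move=> K0 c0 ae ay.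
have a0 : 0 < a := lt_le_trans (expR_gt0 _) ae.
have y0 : 0 < y by lra.
have la := ln_expR1_ge1 ae; have lla := ln_ge0 la.
have lay : ln a <= ln y by rewrite ler_ln.
have llay : ln (ln a) <= ln (ln y) by rewrite ler_ln ?posrE//; lra.
have Kl : K * ln (ln a) <= K * ln (ln y) by rewrite ler_wpM2l.
have Kl0 : 0 <= K * ln (ln a) by rewrite mulr_ge0.
apply: ler_pM; [by rewrite mulr_ge0//; lra|lra| |lra].
by apply: ler_pM => //; lra.
Qed.

(** The barrier is designed so that [q = ln (ln Y)] satisfies
    [q' = K q + c e^(K t)], hence [q' >= K q + c] when [c], [K] and [t]
    are nonnegative. *)
Definition lnln_barrier (z c K t : R) := (z + c * t) * expR (K * t).
Definition barrier (z c K t : R) := expR (expR (lnln_barrier z c K t)).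
Definition dbarrier (z c K t : R) :=
  barrier z c K t * expR (lnln_barrier z c K t) *
  (K * lnln_barrier z c K t + c * expR (K * t)).

Lemma is_derive_barrier z c K t :
  is_derive t 1 (barrier z c K) (dbarrier z c K t).
Proof.
rewrite /dbarrier /barrier /lnln_barrier; apply: is_derive_eq.
rewrite /GRing.scale/=; ring.
Qed.

Lemma derivable_barrier z c K t : derivable (barrier z c K) t 1.
Proof. by case: (is_derive_barrier z c K t). Qed.

Lemma derive1_barrier z c K t : derive1 (barrier z c K) t = dbarrier z c K t.
Proof. by rewrite derive1E; case: (is_derive_barrier z c K t). Qed.

Lemma continuous_barrier z c K : continuous (barrier z c K).
Proof.
by move=> t; apply/differentiable_continuous/derivable1_diffP/derivable_barrier.
Qed.

Lemma continuous_dbarrier z c K : continuous (dbarrier z c K).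
Proof.
move=> t; apply: differentiable_continuous; apply/derivable1_diffP.
by rewrite /dbarrier /barrier /lnln_barrier; apply: ex_derive.
Qed.

Lemma dbarrier_ge z c K t : 0 <= c -> 0 <= K -> 0 <= t ->
  barrier z c K t * ln (barrier z c K t) *
    (K * ln (ln (barrier z c K t)) + c) <=
  dbarrier z c K t.
Proof.
move=> c0 K0 t0; rewrite /dbarrier /barrier !expRK ler_wpM2l//.
by rewrite lerD2l ler_peMr// -expR0 ler_expR mulr_ge0.
Qed.

Lemma integral_dbarrier z c K s t : s < t ->
  \int[mu]_(x in `[s, t]) dbarrier z c K x = barrier z c K t - barrier z c K s.
Proof.
move=> st; rewrite /Rintegral (@continuous_FTC2 _ _ (barrier z c K))//.
- by apply: continuous_subspaceT; exact: continuous_dbarrier.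
- split; first by move=> x _; exact: derivable_barrier.
  + exact/cvg_at_right_filter/continuous_barrier.
  + exact/cvg_at_left_filter/continuous_barrier.
- by move=> x _; exact: derive1_barrier.
Qed.

Lemma within_continuous_ball (D : set R) (f : R -> R) x :
  {within D, continuous f} -> D x -> forall e, 0 < e ->
  exists2 d, 0 < d & forall y, D y -> `|x - y| < d -> `|f x - f y| < e.
Proof.
move=> /subspace_continuousP cf Dx e e0.
have /cvgrPdist_lt/(_ _ e0) := cf _ Dx.
rewrite near_withinE => -[d /= d0 H]; exists d => // y Dy xy.
exact: H.
Qed.

(** The first point at which a continuous function stops being negative is the
    infimum of the set where it is nonnegative; the infimum belongs to that
    set by continuity. *)
Lemma first_nonneg (f : R -> R) a b : {within `[a, b], continuous f} ->
  a <= b -> f a < 0 -> 0 <= f b ->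
  exists2 t, a < t <= b & 0 <= f t /\ forall x, a <= x < t -> f x < 0.
Proof.
move=> cf ab fa fb; pose S := [set x | a <= x <= b /\ 0 <= f x].
have Sb : S b by split => //; rewrite ab lexx.
have lS : lbound S a by move=> x [/andP[]].
have hS : has_inf S by split; [exists b|exists a].
have at_ : a <= inf S by apply: lb_le_inf => //; exists b.
have tb : inf S <= b by apply: ge_inf => //; exists a.
have Dt : (`[a, b]%classic : set R) (inf S) by rewrite /= in_itv/= at_.
have ft : 0 <= f (inf S).
  rewrite leNgt; apply/negP => ft0.
  have e0 : 0 < - f (inf S) by lra.
  have [d d0 H] := within_continuous_ball cf Dt e0.
  have [y Sy yd] := inf_adherent d0 hS.
  have ty : inf S <= y by apply: ge_inf => //; exists a.
  have [yab fy] := Sy.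
  have := H y; rewrite /= in_itv/= yab => /(_ isT).
  rewrite distrC ger0_norm ?subr_ge0// ltrBlDl => /(_ yd).
  have := ler_norm (- (f (inf S) - f y)); rewrite normrN; lra.
exists (inf S).
  rewrite tb andbT lt_neqAle at_ andbT; apply/eqP => aE.
  by move: ft; rewrite -aE; lra.
split => // x /andP[ax xt]; rewrite ltNge; apply/negP => fx.
suff : inf S <= x by lra.
by apply: ge_inf; [exists a|split => //; rewrite ax/=; lra].
Qed.

(** The integral over ]a, s] is small for [s] near [a].  The extension of [f]
    by zero makes sense of it on the closed interval. *)
Lemma Rintegral_itv_left_approx a b (f : R -> R) e : a < b -> 0 < e ->
  mu.-integrable `]a, b[ (EFin \o f) ->
  exists2 s, a < s < b &
    \int[mu]_(x in `]a, b[) f x <= \int[mu]_(x in `]s, b[) f x + e.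
Proof.
move=> ab e0 fi; pose g := f \_ `]a, b[.
have gi : mu.-integrable `[a, b] (EFin \o g).
  apply: (@integrableS _ _ _ _ setT) => //.
  rewrite /g -restrict_EFin; apply/integrable_restrict => //=; by rewrite setTI.
have := parameterized_integral_near_left ab e0 gi.
move=> [d /= d0 H]; pose s := a + Num.min (d / 2) ((b - a) / 2).
have m0 : 0 < Num.min (d / 2) ((b - a) / 2).
  by rewrite lt_min !divr_gt0// subr_gt0.
have md : Num.min (d / 2) ((b - a) / 2) <= d / 2 by rewrite ge_min lexx.
have mb : Num.min (d / 2) ((b - a) / 2) <= (b - a) / 2.
  by rewrite ge_min lexx orbT.
have as_ : a < s by rewrite /s; lra.
have sb : s < b by rewrite /s; lra.
exists s; first by rewrite as_.
have : `|\int[mu]_(x in `[a, s]) g x| < e.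
  apply: H; last exact: ltW.
  by rewrite /ball/= distrC gtr0_norm ?subr_gt0// /s; lra.
rewrite -Rintegral_itv_obnd_cbnd; last first.
  by apply: integrableS gi => //; apply: subset_itv; rewrite bnd_simp// ltW.
have -> : \int[mu]_(x in `]a, s]) g x = \int[mu]_(x in `]a, s]) f x.
  apply: eq_Rintegral => x; rewrite inE/= in_itv/= => /andP[ax xs].
  by rewrite /g patchE mem_set//= in_itv/= ax (le_lt_trans xs).
have := @Rintegral_itvB R f (BRight a) (BLeft b) s fi.
rewrite !bnd_simp => /(_ (ltW as_) sb) <-.
have := ler_norm (\int[mu]_(x in `]a, s]) f x); lra.
Qed.

(** Below the barrier, [A' + B/2 <= G(A) <= G(Y) <= Y'] almost everywhere, where
    [Y] is the barrier and [G(a) = a ln a (K ln (ln a) + 260 K^2)]. *)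
Lemma barrier_increment_le K z s t u A B : 1 <= K ->
  0 < s -> s < t -> t < u -> ac_itv s u A ->
  mu.-integrable `]s, t[ (EFin \o B) ->
  (forall x, s < x < t -> expR 1 <= A x <= barrier z (260 * K ^+ 2) K x) ->
  (forall x, s < x < t -> expR 1 <= B x) ->
  {ae mu, forall x, s < x < t ->
     derive1 A x + B x <= K * A x * ln (B x) * ln (ln (B x))} ->
  A t - A s + 2^-1 * \int[mu]_(x in `]s, t[) B x <=
    barrier z (260 * K ^+ 2) K t - barrier z (260 * K ^+ 2) K s.
Proof.
move=> K1 s0 st tu Aac Bi AY Be AB; set c := 260 * K ^+ 2 in AY *.
have c0 : 0 <= c by have := sqr_ge0 K; rewrite /c; lra.
have K0 : 0 <= K by lra.
have Yicc : mu.-integrable `[s, t] (EFin \o dbarrier z c K).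
  apply: continuous_compact_integrable; first exact: segment_compact.
  by apply: continuous_subspaceT; exact: continuous_dbarrier.
have Yi : mu.-integrable `]s, t[ (EFin \o dbarrier z c K).
  by apply: integrableS Yicc => //; exact: subset_itv_oo_cc.
have Bi2 : mu.-integrable `]s, t[ (EFin \o (fun x => B x * 2^-1)).
  have : mu.-integrable `]s, t[ (fun x => (2^-1)%:E * (EFin \o B) x)%E.
    exact: integrableZl.
  by apply: eq_integrable => // x _; rewrite /= -EFinM mulrC.
have hi : mu.-integrable `]s, t[
    (EFin \o (fun x => dbarrier z c K x - B x * 2^-1)).
  exact: (integrableB _ Yi Bi2).
have := ac_increment_le st tu Aac hi.
rewrite RintegralB// RintegralZr//.
have -> : \int[mu]_(x in `]s, t[) dbarrier z c K x =
    barrier z c K t - barrier z c K s.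
  rewrite -integral_dbarrier// Rintegral_itv_bndo_bndc//.
  rewrite Rintegral_itv_obnd_cbnd//.
  by apply: integrableS Yicc => //; exact: subset_itv_oc_cc.
suff : {ae mu, forall x, s < x < t ->
    derive1 A x <= dbarrier z c K x - B x * 2^-1}.
  by move=> h /(_ h); rewrite lerBrDr mulrC.
move: AB; apply: (@filterS _ _ (ae_filter_ringOfSetsType mu)) => x AB sxt.
have /andP[Ae Ay] := AY _ sxt; have /andP[sx _] := sxt.
have := AB sxt; have := log_loglog_young K1 Ae (Be _ sxt).
have := rate_le K0 c0 Ae Ay.
have := @dbarrier_ge z c K x c0 K0 (ltW (lt_trans s0 sx)).
by rewrite -/c; lra.
Qed.

End logarithmic_gronwall.

Theorem lemma2p3 (R : realType) (T K : R) (A B : R -> R)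
  (T_gt0 : 0 < T)
  (K_ge1 : 1 <= K)
  (A_int : (@lebesgue_measure R).-integrable `]0, T[ (EFin \o A))
  (B_int : (@lebesgue_measure R).-integrable `]0, T[ (EFin \o B))
  (A_ge : forall t : R, 0 < t < T -> expR 1 <= A t)
  (B_ge : forall t : R, 0 < t < T -> expR 1 <= B t)
  (A_ac : abs_continuous_on `]0, T[ A)
  (A_cont : {within `[0, T[, continuous A})
  (AB_ineq : {ae (@lebesgue_measure R), forall t : R, 0 < t < T ->
     derive1 A t + B t <= K * A t * ln (B t) * ln (ln (B t))}) :
  forall t : R, 0 <= t < T ->
    2 * A t + \int[@lebesgue_measure R]_(s in `]0, t[) B s
      <= 512 * K ^+ 2 * (Qbound (A 0) K t) ^+ 2 + 2 * A 0.
Proof.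
move=> t /andP[t_ge0 tT].
(* The lower bound on [A] extends to 0 by continuity. *)
have A0e : expR 1 <= A 0.
  rewrite leNgt; apply/negP => A0e; have e0 : 0 < expR 1 - A 0 by lra.
  have D0 : (`[0, T[%classic : set R) 0 by rewrite /= in_itv/= lexx.
  have [d d0 H] := within_continuous_ball A_cont D0 e0.
  pose y := Num.min (d / 2) (T / 2).
  have y0 : 0 < y by rewrite lt_min !divr_gt0.
  have yd : y <= d / 2 by rewrite ge_min lexx.
  have yT : y <= T / 2 by rewrite ge_min lexx orbT.
  have := H y; rewrite /= in_itv/= (ltW y0) sub0r normrN gtr0_norm//.
  move=> /(_ ltac:(lra) ltac:(lra)).
  have := ler_norm (- (A 0 - A y)); rewrite normrN.
  have := A_ge y; rewrite y0 => /(_ ltac:(lra)); lra.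
have lA0 := ln_expR1_ge1 A0e.
have A0 : 0 < A 0 := lt_le_trans (expR_gt0 _) A0e.
set Q := Qbound (A 0) K t.
have Q0 : 0 < Q by exact: expR_gt0.
have QK : 2 * Q ^+ 2 <= 512 * K ^+ 2 * Q ^+ 2.
  rewrite ler_pM2r ?exprn_gt0//.
  have : 1 <= K ^+ 2 by rewrite exprn_ege1.
  lra.
have [t0|t0] := eqVneq t 0.
  rewrite t0 set_itv_ge ?bnd_simp ?ltxx// Rintegral_set0 addr0 lerDr.
  by apply: le_trans QK; rewrite mulr_ge0 ?sqr_ge0.
have {t_ge0 t0}t_gt0 : 0 < t by rewrite lt_neqAle eq_sym t0.
pose c := 260 * K ^+ 2.
(* The shift [eps] of [ln (ln (A 0))] puts the barrier strictly above [A] at 0,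
   and is scaled so that [ln (ln Y)] is shifted by exactly [ln 2] at time [t],
   which squares [Q]. *)
pose eps := ln 2 / expR (K * t).
have eps0 : 0 < eps by rewrite divr_gt0 ?expR_gt0// ln_gt0// ltr1n.
pose z := ln (ln (A 0)) + eps.
pose Y := barrier z c K.
have AY0 : A 0 < Y 0.
  rewrite /Y /barrier /lnln_barrier !mulr0 addr0 expR0 mulr1.
  have lnA0 : 0 < ln (A 0) by apply: lt_le_trans lA0.
  rewrite -[ltLHS]lnK ?posrE// ltr_expR -[ltLHS]lnK ?posrE//.
  by rewrite ltr_expR /z ltrDl.
have YQ : Y t = Q ^+ 2.
  rewrite /Y /barrier /lnln_barrier /z addrAC mulrDl /eps.
  rewrite divfK ?gt_eqF ?expR_gt0//.
  rewrite expRD lnK ?posrE// [_ * 2]mulrC expRM_natl.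
  by [].
have ACi s u : 0 < s -> u < T -> ac_itv s u A.
  move=> s0 uT; apply: abs_continuous_on_ac_itv A_ac.
  by apply: subset_itv; rewrite bnd_simp.
have Bi s u : 0 <= s -> u <= T ->
    (@lebesgue_measure R).-integrable `]s, u[ (EFin \o B).
  move=> s0 uT; apply: integrableS B_int => //.
  by apply: subset_itv; rewrite bnd_simp.
have step s u : 0 < s -> s < u -> u < T ->
    (forall x, s < x < u -> A x <= Y x) ->
    A u - A s + 2^-1 * \int[@lebesgue_measure R]_(x in `]s, u[) B x <=
    Y u - Y s.
  move=> s0 su uT AY.
  have sub x : s < x < u -> 0 < x < T.
    by move=> /andP[sx xu]; rewrite (lt_trans s0 sx) (lt_trans xu uT).
  have [v /andP[uv vT]] : exists v, u < v < T.
    by exists ((u + T) / 2); rewrite midf_lt// ?midf_lt.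
  apply: (barrier_increment_le K_ge1 s0 su uv); first exact: ACi.
  - by apply: Bi; exact: ltW.
  - by move=> x sxu; rewrite AY// A_ge// sub.
  - by move=> x sxu; rewrite B_ge// sub.
  - move: AB_ineq.
    apply: (@filterS _ _ (ae_filter_ringOfSetsType (@lebesgue_measure R))).
    by move=> x AB sxu; apply: AB; exact: sub.
have cY : continuous Y by exact: continuous_barrier.
clearbody Y Q.
have AY x : 0 <= x -> x < T -> A x < Y x.
  move=> x0 xT; rewrite ltNge; apply/negP => YA.
  have cf : {within `[0, x], continuous (A \- Y)}.
    have cA : {within `[0, x], continuous A}.
      apply: continuous_subspaceW A_cont.
      by apply: subset_itv; rewrite bnd_simp.
    have cYx : {within `[0, x], continuous Y} by exact: continuous_subspaceT.
    by move=> y; apply: continuousB; [exact: cA|exact: cYx].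
  have f0 : (A \- Y) 0 < 0 by rewrite /=; lra.
  have fx : 0 <= (A \- Y) x by rewrite /=; lra.
  have [u /andP[u0 ux] [fu fl]] := first_nonneg cf x0 f0 fx.
  (* By [step], the gap [Y - A] at the first contact time [u] is at least its
     value at [u / 2], which is positive; any time in ]0, u[ would do. *)
  have u2 : 0 <= u / 2 < u by lra.
  have := fl _ u2; have := fu; rewrite /=.
  have := step (u / 2) u ltac:(lra) ltac:(lra) ltac:(lra).
  have AYu y : u / 2 < y < u -> A y <= Y y.
    move=> /andP[uy yu]; have := fl y.
    by rewrite /= yu andbT => /(_ ltac:(lra)); lra.
  move=> /(_ AYu).
  have : 0 <= \int[@lebesgue_measure R]_(y in `]u / 2, u[) B y.
    apply: Rintegral_ge0 => y; rewrite /= in_itv/= => /andP[uy yu].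
    by rewrite (le_trans (expR_ge0 1))// B_ge//; apply/andP; split; lra.
  lra.
(* As [Y t = Q ^+ 2], it remains to let [s] tend to 0 in [step s t]. *)
suff h : 2^-1 * \int[@lebesgue_measure R]_(s in `]0, t[) B s <= Y t - A t.
  rewrite YQ in h; move: (\int[_]_(s in _) _) h => I h.
  move: (512 * _ * _) QK => M QK.
  move: (A t) (A 0) (Q ^+ 2) A0 h QK => a a0 q a0_gt0 h QK.
  by clear -a0_gt0 h QK; lra.
apply/ler_addgt0Pr => e e0.
have Bi0 : (@lebesgue_measure R).-integrable `]0, t[ (EFin \o B).
  by apply: Bi => //; exact: ltW.
have [s /andP[s0 st]] := Rintegral_itv_left_approx t_gt0 e0 Bi0.
have := step s t s0 st tT.
have AYs y : s < y < t -> A y <= Y y.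
  move=> /andP[sy yt]; apply/ltW/AY; last exact: lt_trans tT.
  exact: ltW (lt_trans s0 sy).
move=> /(_ AYs); have := AY s (ltW s0) (lt_trans st tT).
lra.
Qed.
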